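(* Let $X$ be a $\mathcal{B}$ real Banach space, $C$ a nonempty closed convex subset of $X$, $T:C\to C$ a nonexpansive mapping with $\mathrm{Fix}(T)\ne\emptyset$, and $f:C\to C$ an $\alpha$-contraction for some $\alpha\in(0,1)$. Let $\{\alpha_n\}$ be a sequence of real numbers such that: (i) $\alpha_n\in(0,1)$ for all $n$; (ii) $\lim_{n\to\infty}\alpha_n=0$; (iii) $\sum_{n=0}^\infty\alpha_n=\infty$; and either (iv) $\sum_{n=0}^\infty|\alpha_{n+1}-\alpha_n|<\infty$ or (iv') $\lim_{n\to\infty}\alpha_{n+1}/\alpha_n=1$. Let $\{\beta_n\}\subset[0,1]$ be a sequence converging to zero and satisfying either $\sum_{n=0}^\infty|\beta_{n+1}-\beta_n|<\infty$ or $|\beta_{n+1}-\beta_n|/\alpha_n\to0$. Let $x_0\in C$ and $$x_{n+1}=\alpha_nf(x_n)+(1-\alpha_n)T_nx_n,\qquad T_nx:=\beta_nx+(1-\beta_n)Tx .$$ Then $\{x_n\}$ converges strongly to $\mathbf{Q}_{\mathrm{Fix}(T)}(f)$.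
   Context: A mapping $T:C\to C$ is nonexpansive if $\|Tx-Ty\|\le\|x-y\|$ for all $x,y\in C$; $f:C\to C$ is an $\alpha$-contraction ($\alpha\in(0,1)$) if $\|f(x)-f(y)\|\le\alpha\|x-y\|$ for all $x,y\in C$. $\mathrm{Fix}(T)=\{x\in C: Tx=x\}$. The normalized duality map is $J(x)=\{x^\star\in X^\star:\langle x,x^\star\rangle=\|x\|^2=\|x^\star\|^2\}$. A ''$\mathcal{B}$ real Banach space'' is a real Banach space $X$ such that either (a) the normalized duality mapping $J$ is (single-valued and) uniformly norm-to-weak$^\star$ continuous on bounded sets, or (b) $X$ is reflexive and admits a weakly continuous duality mapping $J_\phi$ with gauge $\phi$, i.e. $\phi:[0,\infty)\to[0,\infty)$ is continuous, strictly increasing, $\phi(0)=0$, $\phi(t)\to\infty$ as $t\to\infty$, and $J_\phi(x)=\{x^\star\in X^\star:\langle x,x^\star\rangle=\|x\|\phi(\|x\|),\ \|x^\star\|=\phi(\|x\|)\}$ is single-valued and weak-to-weak$^\star$ sequentially continuous. Definition of $\mathbf{Q}_{\mathrm{Fix}(T)}(f)$: for $u\in C$ and $t\in(0,1)$ let $z_t\in C$ be the unique fixed point of $x\mapsto tu+(1-t)Tx$, and let $R_T(u)=\lim_{t\to0}z_t$ (strong limit). It is understood that this limit exists for every $u\in C$. Then $R_T$ is a nonexpansive retraction of $C$ onto $\mathrm{Fix}(T)$, and $\mathbf{Q}_{\mathrm{Fix}(T)}(f)$ is the unique fixed point $\tilde x=R_T(f(\tilde x))$ of the contraction $R_T\circ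 f$. *)

(* Defs.v *)
From HB Require Import structures.
From mathcomp Require Import all_boot all_order all_algebra.
From mathcomp Require Import all_classical all_reals all_analysis.
Import Order.TTheory GRing.Theory Num.Theory.
Import numFieldNormedType.Exports.

Set Implicit Arguments.
Unset Strict Implicit.
Unset Printing Implicit Defensive.

Local Open Scope classical_set_scope.
Local Open Scope ring_scope.

(* The dual X^* is represented as a subset of the functions X -> R. *)
Definition dual (R : realType) (X : normedModType R) : set (X -> R^o) :=
  [set l | linear l /\ continuous l].

Definition dual_norm (R : realType) (X : normedModType R) (l : X -> R^o) : R :=
  sup [set `|l v| | v in [set v : X | `|v| <= 1]].

Definition duality_map (R : realType) (X : normedModType R) (x : X) :
    set (X -> R^o) :=
  [set l | [/\ dual l, l x = `|x| ^+ 2 & `|x| ^+ 2 = dual_norm l ^+ 2]].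

Definition duality_map_gauge (R : realType) (X : normedModType R) (phi : R -> R)
    (x : X) : set (X -> R^o) :=
  [set l | [/\ dual l, l x = `|x| * phi `|x| & dual_norm l = phi `|x|]].

(* A gauge lives on [0, +oo[; its values at negative arguments are irrelevant. *)
Definition gauge_function (R : realType) (phi : R -> R) : Prop :=
  [/\ forall t : R, 0 <= t -> 0 <= phi t,
      {within [set t | 0 <= t], continuous phi},
      forall s t : R, 0 <= s -> s < t -> phi s < phi t,
      phi 0 = 0
    & phi t @[t --> +oo] --> +oo].

(* The weak* uniformity on X^* is the one induced by {ptws X -> R^o}. *)
Definition unif_norm_to_weakstar_on_bounded (R : realType) (X : normedModType R)
    (j : X -> {ptws X -> R^o}) : Prop :=
  forall B : set X, [bounded x | x in B] ->
  forall E : set ({ptws X -> R^o} * {ptws X -> R^o}), entourage E ->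
  \forall p \near @entourage X, B p.1 -> B p.2 -> E (j p.1, j p.2).

Definition weak_cvg (R : realType) (X : normedModType R) (u : nat -> X) (x : X) :
    Prop :=
  forall l, @dual R X l -> l (u n) @[n --> \oo] --> l x.

Definition weak_to_weakstar_seq_continuous (R : realType) (X : normedModType R)
    (j : X -> {ptws X -> R^o}) : Prop :=
  forall (u : nat -> X) (x : X), weak_cvg u x -> j (u n) @[n --> \oo] --> j x.

(* An element of the bidual is a function on all of X -> R^o of which only the
   restriction to X^* matters: linear there, and bounded for the dual norm. *)
Definition bidual (R : realType) (X : normedModType R) : set ((X -> R^o) -> R) :=
  [set Phi |
    (forall (a : R) (l m : X -> R^o), dual l -> dual m ->
       Phi (fun v => a * l v + m v) = a * Phi l + Phi m) /\
    (exists M : R, forall l, dual l -> `|Phi l| <= M * dual_norm l)].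

Definition reflexive_space (R : realType) (X : normedModType R) : Prop :=
  forall Phi, @bidual R X Phi -> exists x : X, forall l, dual l -> Phi l = l x.

Definition B_space (R : realType) (X : completeNormedModType R) : Prop :=
  (exists j : X -> {ptws X -> R^o},
     (forall x, duality_map x = [set j x]) /\
     unif_norm_to_weakstar_on_bounded j)
  \/
  (reflexive_space X /\
   exists phi : R -> R, gauge_function phi /\
   exists j : X -> {ptws X -> R^o},
     (forall x, duality_map_gauge phi x = [set j x]) /\
     weak_to_weakstar_seq_continuous j).

Definition Fix (R : realType) (X : normedModType R) (C : set X) (T : X -> X) :
    set X :=
  [set x | C x /\ T x = x].

(* z_t: for T nonexpansive on the closed convex C, u in C and 0 < t < 1, the set
   below is a singleton by Banach's contraction principle. *)
Definition zpath (R : realType) (X : normedModType R) (C : set X) (T : X -> X)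
    (u : X) (t : R) : X :=
  get (Fix C (fun x => t *: u + (1 - t) *: T x)).

Definition RT (R : realType) (X : normedModType R) (C : set X) (T : X -> X)
    (u : X) : X :=
  lim (zpath C T u t @[t --> 0^'+]).

Definition is_Q (R : realType) (X : normedModType R) (C : set X) (T f : X -> X)
    (q : X) : Prop :=
  Fix C (fun x => RT C T (f x)) = [set q].

(* Main.v *)
(* With q = R_T(f(q)), the iterates satisfy
     |x_{n+1} - q|^2 <= (1 - (1-alpha) a_n) |x_n - q|^2
                        + 2 a_n <f(q) - q, J(x_{n+1} - q)>,
   so x_n -> q follows once limsup <f(q) - q, J(x_n - q)> <= 0. The conditions on
   a and b make the increments, hence x_n - T x_n, tend to 0, and expanding
   |x_n - z_t|^2 for the path z_t = t f(q) + (1-t) T z_t, which tends to q, gives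
     <f(q) - z_t, J(x_n - z_t)> <= O(t) + O(|x_n - T x_n|) / t.
   Passing from z_t to q needs J to be norm-to-weak* uniformly continuous on
   bounded sets. This also holds in a reflexive space with a weakly sequentially
   continuous duality map, because bounded sequences have weakly convergent
   subsequences; so demiclosedness and Opial's property are not needed. *)
Require Import Defs.
From HB Require Import structures.
From mathcomp Require Import all_boot all_order all_algebra.
From mathcomp Require Import ring lra.
From mathcomp Require Import all_classical all_reals all_analysis.
Import Order.TTheory GRing.Theory Num.Theory.
Import numFieldNormedType.Exports.

Set Implicit Arguments.
Unset Strict Implicit.
Unset Printing Implicit Defensive.

Local Open Scope classical_set_scope.
Local Open Scope ring_scope.

(** * The Hahn-Banach theorem *)

Section HahnBanach.
Context {R : realType} {V : lmodType R}.
Implicit Types (p q : V -> R) (x y v : V).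

(** Homogeneity is asked only as an inequality for [0 < r], the form that infima satisfy directly;
    applying it to [r^-1] gives equality. *)
Definition sublinear p :=
  (forall x y, p (x + y) <= p x + p y) /\
  (forall r x, 0 < r -> p (r *: x) <= r * p x).

Lemma sublinear0 p : sublinear p -> p 0 = 0.
Proof.
move=> [_ pZ].
have := pZ 2 0 ltac:(lra); have := pZ 2^-1 0 ltac:(lra).
by rewrite !scaler0; lra.
Qed.

Lemma sublinear_ge_opp p x : sublinear p -> - p (- x) <= p x.
Proof.
move=> sp; have := sp.1 x (- x); rewrite subrr (sublinear0 sp).
by lra.
Qed.

Lemma sublinear_scale p r x : sublinear p -> 0 < r -> p (r *: x) = r * p x.
Proof.
move=> sp r0; apply/eqP; rewrite eq_le sp.2//=.
have ri0 : 0 < r^-1 by rewrite invr_gt0.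
have := sp.2 _ (r *: x) ri0; rewrite scalerA mulVf ?gt_eqF// scale1r.
by rewrite ler_pdivlMl.
Qed.

(** For sublinear [p], the largest sublinear minorant [q] of [p] with [q (- x) <= - p x], since then
    [q y <= q (y + t *: x) + t * q (- x)]. *)
Let lower p x y := inf [set p (y + t *: x) - t * p x | t in [set t : R | 0 <= t]].

Let lower_lb p x y : sublinear p ->
  has_inf [set p (y + t *: x) - t * p x | t in [set t : R | 0 <= t]].
Proof.
move=> sp; split; first by exists (p (y + 0 *: x) - 0 * p x), 0 => //=.
exists (- p (- y)) => _ [t t0 <-].
have /orP[/eqP <-|tp] : (0 == t) || (0 < t) by rewrite -le_eqVlt.
  by rewrite scale0r addr0 mul0r subr0 sublinear_ge_opp.
have := sp.1 (y + t *: x) (- y).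
by rewrite addrC addKr sublinear_scale//; lra.
Qed.

Let lower_le_at p x y (t : R) : sublinear p -> 0 <= t ->
  lower p x y <= p (y + t *: x) - t * p x.
Proof.
by move=> sp t0; apply: ge_inf; [exact: (lower_lb _ _ sp).2|exists t].
Qed.

Let lower_le p x y : sublinear p -> lower p x y <= p y.
Proof.
move=> sp; have := lower_le_at x y sp (lexx 0).
by rewrite scale0r addr0 mul0r subr0.
Qed.

Let lower_opp p x : sublinear p -> lower p x (- x) <= - p x.
Proof.
move=> sp; have := lower_le_at x (- x) sp ler01.
by rewrite scale1r addNr sublinear0// mul1r sub0r.
Qed.

(** Nearly optimal parameters at [y] and [z] add up to an admissible one at [y + z]; at [r *: y] the
    parameter [t] becomes [r * t]. *)
Let lower_sublinear p x : sublinear p -> sublinear (lower p x).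
Proof.
move=> sp; split=> [y z|r y r0].
  apply/ler_addgt0Pr => e e0.
  have e20 : 0 < e / 2 by lra.
  have [_ [t t0 <-] ty] := inf_adherent e20 (lower_lb x y sp).
  have [_ [s s0 <-] sz] := inf_adherent e20 (lower_lb x z sp).
  have ts0 : 0 <= t + s by rewrite addr_ge0.
  have := lower_le_at x (y + z) sp ts0.
  have := sp.1 (y + t *: x) (z + s *: x).
  rewrite addrACA -scalerDl => spyz low.
  rewrite -/(lower p x y) in ty; rewrite -/(lower p x z) in sz.
  by lra.
rewrite mulrC -ler_pdivrMr//; apply: lb_le_inf.
  exact: (lower_lb x y sp).1.
move=> _ [t t0 <-]; rewrite ler_pdivrMr//.
have rt0 : 0 <= r * t by rewrite mulr_ge0// ltW.
have := lower_le_at x (r *: y) sp rt0.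
rewrite -scalerA -scalerDr (sublinear_scale _ sp r0) => /le_trans; apply.
by rewrite le_eqVlt; apply/orP; left; apply/eqP; ring.
Qed.

(* [lower p x] is a sublinear minorant of [p] whose value at [- x] is at most
   [- p x]; if it equals [p], then [p] is odd at [x]. *)
Lemma minimal_sublinear_linear p :
  sublinear p -> (forall q, sublinear q -> (forall x, q x <= p x) -> q = p) ->
  linear (p : V -> R^o).
Proof.
move=> sp pmin.
have pN x : p (- x) = - p x.
  apply/eqP; rewrite eq_le; apply/andP; split.
    rewrite -{1}(pmin _ (lower_sublinear x sp)) ?lower_opp// => y.
    exact: lower_le.
  by have := sublinear_ge_opp (- x) sp; rewrite opprK.
have pD x y : p (x + y) = p x + p y.
  apply/eqP; rewrite eq_le sp.1/=.
  by have := sp.1 (- x) (- y); rewrite -opprD !pN; lra.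
move=> r x y; rewrite pD; congr (_ + _).
have [r0|r0|->] := ltgtP r 0.
- have rn : 0 < - r by lra.
  rewrite -[LHS]opprK -pN -scaleNr (sublinear_scale _ sp rn).
  by rewrite mulNr opprK.
- exact: sublinear_scale.
- by rewrite !scale0r sublinear0.
Qed.

(** Zorn's lemma on the sublinear minorants of [p]: the pointwise infimum of a chain is again one,
    and a minimal one is linear. *)
Lemma exists_linear_below p : sublinear p ->
  exists l : V -> R^o, linear l /\ forall x, l x <= p x.
Proof.
move=> sp.
pose T := {q : V -> R | sublinear q /\ forall x, q x <= p x}.
(* The order is reversed, so that a maximal element for [r] is a minimal functional. *)
pose r (s t : T) := `[< forall x, sval t x <= sval s x >].
have [||||t tmin] := @Zorn T r.
- by move=> t; apply/asboolP.
- move=> s1 s2 s3 /asboolP h1 /asboolP h2; apply/asboolP => x.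
  exact: le_trans (h2 x) (h1 x).
- move=> [s ps] [t pt] /asboolP/= h1 /asboolP/= h2; apply/eq_exist/funext => x.
  by apply/eqP; rewrite eq_le h1 h2.
- move=> A Atot.
  have [[t0 At0]|An] := pselect (A !=set0); last first.
    exists (exist _ p (conj sp (fun x => lexx (p x)))) => s As.
    by exfalso; apply: An; exists s.
  pose m x := inf [set sval t x | t in A].
  have mi x : has_inf [set sval t x | t in A].
    split; first by exists (sval t0 x), t0.
    exists (- p (- x)) => _ [t At <-]; have [st tp] := svalP t.
    by apply: le_trans (sublinear_ge_opp x st); rewrite lerN2.
  have mle x t : A t -> m x <= sval t x.
    by move=> At; apply: ge_inf; [exact: (mi x).2|exists t].
  have sm : sublinear m.
    split=> [y z|a y a0].
      apply/ler_addgt0Pr => e e0.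
      have e20 : 0 < e / 2 by lra.
      have [_ [t At <-] ty] := inf_adherent e20 (mi y).
      have [_ [s As <-] sz] := inf_adherent e20 (mi z).
      rewrite -/(m y) in ty; rewrite -/(m z) in sz.
      (* In a chain, the smaller of [s] and [t] is nearly optimal at both [y] and [z], and its own
         subadditivity concludes. *)
      have [/asboolP h|/asboolP h] := Atot _ _ At As.
        have := (svalP s).1.1 y z; have := mle (y + z) _ As; have := h y; lra.
      have := (svalP t).1.1 y z; have := mle (y + z) _ At; have := h z; lra.
    rewrite mulrC -ler_pdivrMr//; apply: lb_le_inf; first exact: (mi y).1.
    move=> _ [t At <-]; rewrite ler_pdivrMr// mulrC.
    exact: le_trans (mle _ _ At) ((svalP t).1.2 _ _ a0).
  have mp x : m x <= p x by apply: le_trans (mle x _ At0) ((svalP t0).2 x).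
  by exists (exist _ m (conj sm mp)) => s As; apply/asboolP => x; exact: mle.
have [st tp] := svalP t.
exists (sval t); split=> //; apply: minimal_sublinear_linear => // q sq qt.
have qp x : q x <= p x by apply: le_trans (qt x) (tp x).
by rewrite -(tmin (exist _ q (conj sq qp)))//; apply/asboolP.
Qed.

(** Any linear functional below [lower p v] works: its value at [- v] is at most [- p v], which
    forces [l v = p v]. *)
Lemma hahn_banach p v : sublinear p ->
  exists l : V -> R^o, [/\ linear l, forall x, l x <= p x & l v = p v].
Proof.
move=> sp; have [l [ll lp]] := exists_linear_below (lower_sublinear v sp).
have lpp x : l x <= p x by apply: le_trans (lp x) (lower_le v x sp).
exists l; split=> //; apply/eqP; rewrite eq_le lpp/=.
have := le_trans (lp (- v)) (lower_opp v sp).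
have l0 : l 0 = 0 by have := ll (-1) 0 0; rewrite scaler0 addr0 scaleN1r addNr.
by have := ll (-1) v 0; rewrite addr0 l0 addr0 !scaleN1r => ->; rewrite lerN2.
Qed.

End HahnBanach.

(** * Continuous linear functionals *)

Section Dual.
Context {R : realType} {X : normedModType R}.
Implicit Types (l m : X -> R^o) (x y v : X).

Lemma linear_funD l x y : linear l -> l (x + y) = l x + l y.
Proof. by move=> /(_ 1 x y); rewrite !scale1r. Qed.

Lemma linear_fun0 l : linear l -> l 0 = 0.
Proof. by move=> /(_ (-1) 0 0); rewrite scaler0 addr0 scaleN1r addNr. Qed.

Lemma linear_funZ l (r : R) x : linear l -> l (r *: x) = r * l x.
Proof. by move=> ll; have := ll r x 0; rewrite addr0 linear_fun0// addr0. Qed.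

Lemma linear_funN l x : linear l -> l (- x) = - l x.
Proof. by move=> ll; rewrite -scaleN1r linear_funZ// mulN1r. Qed.

Lemma linear_funB l x y : linear l -> l (x - y) = l x - l y.
Proof. by move=> ll; rewrite linear_funD// linear_funN. Qed.

Lemma bounded_dual l (M : R) :
  linear l -> (forall x, `|l x| <= M * `|x|) -> dual l.
Proof.
move=> ll lM; split=> //.
pose L : {linear X -> R^o} := HB.pack l (GRing.isLinear.Build R X R^o _ l ll).
suff : continuous L by [].
apply: bounded_linear_continuous; apply/linear_boundedP.
exists M; split=> [|r /ltW Mr x]; first exact: num_real.
by rewrite (le_trans (lM x))// ler_wpM2r.
Qed.

Lemma dual_bounded l : dual l -> exists2 M, 0 < M & forall x, `|l x| <= M * `|x|.
Proof.
move=> [ll lc].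
pose L : {linear X -> R^o} := HB.pack l (GRing.isLinear.Build R X R^o _ l ll).
have : bounded_near L (nbhs 0) by apply: continuous_linear_bounded; exact: lc.
by move=> /linear_boundedP/pinfty_ex_gt0.
Qed.

Let ball_image l := [set `|l v| | v in [set v : X | `|v| <= 1]].

Let ball_image_sup l : dual l -> has_sup (ball_image l).
Proof.
move=> ld; split; first by exists `|l 0|, 0 => //=; rewrite normr0.
have [M M0 lM] := dual_bounded ld.
by exists M => _ [v /= v1 <-]; rewrite (le_trans (lM v))// ler_piMr// ltW.
Qed.

Lemma dual_norm_ge0 l : dual l -> 0 <= dual_norm l.
Proof.
move=> ld; apply: le_trans (normr_ge0 (l 0)) _.
apply: sup_upper_bound; first exact: ball_image_sup.
by exists 0 => //=; rewrite normr0.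
Qed.

Lemma dual_normP l x : dual l -> `|l x| <= dual_norm l * `|x|.
Proof.
move=> ld; have [->|x0] := eqVneq x 0.
  by rewrite linear_fun0 ?normr0 ?mulr0//; case: ld.
have nx0 : 0 < `|x| by rewrite normr_gt0.
rewrite -ler_pdivrMr//; apply: sup_upper_bound; first exact: ball_image_sup.
exists (`|x|^-1 *: x) => /=.
  by rewrite normrZ normfV normr_id mulVf// gt_eqF.
by rewrite linear_funZ ?normrM ?normfV ?normr_id 1?mulrC//; case: ld.
Qed.

Lemma norming_functional x :
  exists l, [/\ dual l, forall v, `|l v| <= `|v| & l x = `|x|].
Proof.
have sn : sublinear (fun v : X => `|v|).
  split=> [u v|r v r0]; first exact: ler_normD.
  by rewrite normrZ gtr0_norm.
have [l [ll ln lx]] := hahn_banach x sn.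
have lb v : `|l v| <= `|v|.
  rewrite ler_norml ln andbT lerNl -linear_funN// -(normrN v).
  exact: ln.
by exists l; split=> //; apply: (@bounded_dual _ 1) => // v; rewrite mul1r.
Qed.

End Dual.

(** * Limits along ultrafilters *)

Lemma ultra_bounded_cvg (R : realType) (T : Type) (F : set_system T)
    (UF : UltraFilter F) (u : T -> R) (M : R) :
  (forall t, `|u t| <= M) -> exists a : R, u t @[t --> F] --> a.
Proof.
move=> uM.
have FP : ProperFilter F by exact: ultra_proper.
(* Compactness gives a cluster point, and a cluster point of an ultrafilter is a limit: of [A] and
   its complement, one lies in the filter. *)
have [a [_ clua]] : `[- M, M] `&` cluster (u @ F) !=set0.
  apply: segment_compact; apply: (@filterE _ F) => t /=.
  by rewrite in_itv/= -ler_norml.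
exists a => A Aa.
have [//|FA] := in_ultra_setVsetC (u @^-1` A) UF.
by have [b []] := clua (~` A) A FA Aa.
Qed.

(** The limits of [l (y t)] along [F] define an element of the bidual, of norm at most [M];
    reflexivity represents it by a point. *)
Lemma reflexive_ultra_cvg (R : realType) (X : normedModType R) (T : Type)
    (F : set_system T) (UF : UltraFilter F) (y : T -> X) (M : R) :
  reflexive_space X -> (forall t, `|y t| <= M) ->
  exists v, forall l, dual l -> l (y t) @[t --> F] --> l v.
Proof.
move=> rX yM.
have FP : ProperFilter F by exact: ultra_proper.
have lyb l : dual l -> forall t, `|l (y t)| <= M * dual_norm l.
  move=> ld t; rewrite (le_trans (dual_normP _ ld))// mulrC ler_wpM2r//.
  exact: dual_norm_ge0.
(* [lim] takes a default value where there is no limit; [bidual] only looks at [l] in the dual,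
   where the limit exists. *)
pose Phi (l : X -> R^o) : R := lim (l (y t) @[t --> F]).
have PhiP l : dual l -> l (y t) @[t --> F] --> Phi l.
  move=> ld; have [a la] := ultra_bounded_cvg UF (lyb l ld).
  by apply/cvg_ex; exists a.
have [v Phiv] : exists v, forall l, dual l -> Phi l = l v.
  apply: rX; split.
    move=> a l m ld md; apply: cvg_lim => //.
    by apply: cvgD; [apply: cvgMl_tmp; exact: PhiP|exact: PhiP].
  exists M => l ld; apply: cvgr_to_le (cvg_norm (PhiP l ld)) _.
  by apply: nearW => t; exact: lyb.
by exists v => l ld; rewrite -Phiv//; exact: PhiP.
Qed.

(** * Weak sequential compactness in reflexive spaces *)

Section Span.
Context {R : realType} {X : normedModType R} (y : nat -> X).

Definition real_comb (s : seq (R * nat)) : X := \sum_(c <- s) c.1 *: y c.2.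

(** Lists over the rationals form a countable type, as the enumeration by [pickle] requires. *)
Definition rat_comb (s : seq (rat * nat)) : X :=
  \sum_(c <- s) (ratr c.1 : R) *: y c.2.

Let real_combZ (r : R) s :
  real_comb [seq (r * c.1, c.2) | c <- s] = r *: real_comb s.
Proof.
rewrite /real_comb big_map scaler_sumr.
by apply: eq_bigr => c _; rewrite scalerA.
Qed.

Let dist_span (x : X) : R := inf [set `|x - real_comb s| | s in setT].

Let dist_lb x : has_inf [set `|x - real_comb s| | s in setT].
Proof.
split; first by exists `|x - real_comb [::]|, [::].
by exists 0 => _ [s _ <-].
Qed.

Let dist_le x s : dist_span x <= `|x - real_comb s|.
Proof. by apply: ge_inf; [exact: (dist_lb x).2|exists s]. Qed.

Let dist_sublinear : sublinear dist_span.
Proof.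
split=> [u v|r u r0].
  apply/ler_addgt0Pr => e e0.
  have e20 : 0 < e / 2 by lra.
  have [_ [s _ <-] us] := inf_adherent e20 (dist_lb u).
  have [_ [t _ <-] vt] := inf_adherent e20 (dist_lb v).
  have := dist_le (u + v) (s ++ t).
  rewrite /real_comb big_cat/= opprD addrACA => le1.
  have := ler_normD (u - real_comb s) (v - real_comb t).
  rewrite -/(dist_span u) in us; rewrite -/(dist_span v) in vt.
  by rewrite /real_comb in us vt *; lra.
rewrite mulrC -ler_pdivrMr//; apply: lb_le_inf; first exact: (dist_lb u).1.
move=> _ [s _ <-]; rewrite ler_pdivrMr// mulrC.
apply: le_trans (dist_le _ [seq (r * c.1, c.2) | c <- s]) _.
by rewrite real_combZ -scalerBr normrZ gtr0_norm.
Qed.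

(* Hahn-Banach applied to the distance to the span, which is sublinear. *)
Lemma mem_closed_span v :
  (forall l, dual l -> (forall k, l (y k) = 0) -> l v = 0) ->
  forall e, 0 < e -> exists s, `|v - real_comb s| < e.
Proof.
move=> vanish e e0.
have [l [ll ld lv]] := hahn_banach v dist_sublinear.
have dn x : dist_span x <= `|x|.
  by have := dist_le x [::]; rewrite /real_comb big_nil subr0.
have l_norm x : `|l x| <= `|x|.
  rewrite ler_norml (le_trans (ld x) (dn x)) andbT lerNl -linear_funN//.
  by rewrite -(normrN x) (le_trans (ld _)).
have ly k : l (y k) = 0.
  have := le_trans (ld (y k)) (dist_le (y k) [:: (1, k)]).
  have := le_trans (ld (- y k)) (dist_le (- y k) [:: (-1, k)]).
  rewrite /real_comb !big_cons !big_nil/= scaleN1r scale1r !addr0 !subrr.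
  by rewrite normr0 linear_funN//; lra.
have l0 : dist_span v = 0.
  rewrite -lv; apply: vanish => //.
  by apply: (@bounded_dual _ _ _ 1) => // x; rewrite mul1r.
have [_ [s _ <-]] := inf_adherent e0 (dist_lb v).
by rewrite -/(dist_span v) l0 add0r => ?; exists s.
Qed.

Lemma rat_comb_dense s (e : R) : 0 < e ->
  exists t, `|real_comb s - rat_comb t| < e.
Proof.
elim: s e => [|[r k] s IH] e e0.
  by exists [::]; rewrite /real_comb /rat_comb !big_nil subrr normr0.
have e20 : 0 < e / 2 by lra.
have [t st] := IH _ e20.
(* The new coefficient may cost [e / 2]; the [+ 1] covers the case [y k = 0]. *)
pose d := e / 2 / (`|y k| + 1).
have yk : 0 < `|y k| + 1 by rewrite ltr_wpDl.
have d0 : 0 < d by rewrite divr_gt0.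
have [q] : exists q : rat, ratr q \in `]r - d, r + d[.
  by apply: rat_in_itvoo; lra.
rewrite in_itv/= => /andP[rq qr].
exists ((q, k) :: t); rewrite /real_comb /rat_comb !big_cons/=.
rewrite opprD addrACA -scalerBl.
apply: le_lt_trans (ler_normD _ _) _.
rewrite (splitr e) ler_ltD// normrZ.
have rqd : `|r - ratr q| <= d by rewrite ler_norml; apply/andP; split; lra.
apply: le_trans (ler_wpM2r (normr_ge0 _) rqd) _.
by rewrite mulrAC ler_pdivrMr// ler_pM2l// lerDl.
Qed.

(* [l c] norms [rat_comb c], and these vectors are dense in the closed span. *)
Lemma norming_separates (l : seq (rat * nat) -> X -> R^o) w :
  (forall c, dual (l c)) -> (forall c v, `|l c v| <= `|v|) ->
  (forall c, l c (rat_comb c) = `|rat_comb c|) ->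
  (forall m, dual m -> (forall k, m (y k) = 0) -> m w = 0) ->
  (forall c, l c w = 0) -> w = 0.
Proof.
move=> ld lb ln wspan lw; apply/eqP; rewrite -normr_le0.
apply/ler_addgt0Pr => e e0; rewrite add0r.
have e40 : 0 < e / 4 by lra.
have [s ws] := mem_closed_span wspan e40.
have [c sc] := rat_comb_dense s e40.
have wc : `|w - rat_comb c| < e / 2.
  have := ler_normD (w - real_comb s) (real_comb s - rat_comb c).
  by rewrite addrA subrK; lra.
have : `|rat_comb c| <= `|w - rat_comb c|.
  apply: le_trans (lb c _); have [lin _] := ld c.
  by rewrite linear_funB// lw sub0r normrN ln normr_id.
have := ler_normD (w - rat_comb c) (rat_comb c); rewrite subrK.
by lra.
Qed.

End Span.

(** Only finitely many [c] have a code below [n], so this is a finite intersection. It lets one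
    index serve finitely many functionals at once. *)
Lemma filter_pickle_lt (T : countType) (I : Type) (F : set_system I)
    (FF : Filter F) (P : T -> set I) :
  (forall c, F (P c)) ->
  forall n, F [set k | forall c, (pickle c < n)%N -> P c k].
Proof.
move=> FP; elim=> [|n IH]; first by apply: filterE => k c.
have [[c0 c0n]|cn] := pselect (exists c : T, pickle c = n).
  near=> k => c; rewrite ltnS leq_eqVlt => /orP[/eqP|].
    rewrite -c0n => /(pcan_inj pickleK) ->; near: k; exact: FP.
  by move: c; near: k.
apply: filterS IH => k Pk c; rewrite ltnS leq_eqVlt => /orP[/eqP ?|]; last exact: Pk.
by exfalso; apply: cn; exists c.
Unshelve. all: by end_near. Qed.

(* Eberlein-Smulian: follow an ultrafilter limit [v] closely enough along a
   countable set of functionals separating the points of the closed span. *)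
Theorem reflexive_weak_subsequence (R : realType) (X : normedModType R)
    (y : nat -> X) (M : R) :
  reflexive_space X -> (forall n, `|y n| <= M) ->
  exists (s : nat -> nat) (v : X) (r : R),
    [/\ forall n, (n <= s n)%N, weak_cvg (y \o s) v & `|y (s n)| @[n --> \oo] --> r].
Proof.
move=> rX yM.
have [U [UU ooU]] := ultraFilterLemma (F := \oo) _.
have PU : ProperFilter U by exact: ultra_proper.
have [v yv] := reflexive_ultra_cvg UU rX yM.
have [r yr] : exists r : R, `|y t| @[t --> U] --> r.
  by apply: (ultra_bounded_cvg UU) => t; rewrite normr_id; exact: yM.
have [l lP] := choice (fun c => norming_functional (rat_comb y c)).
have ld c : dual (l c) by have [] := lP c.
have lb c x : `|l c x| <= `|x| by have [] := lP c.
have ln c : l c (rat_comb y c) = `|rat_comb y c| by have [] := lP c.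
have /choice[s sP] n : exists k, [/\ (n <= k)%N,
    forall c, (pickle c < n)%N -> `|l c v - l c (y k)| < n.+1%:R^-1
    & `|r - `|y k| | < n.+1%:R^-1].
  apply: (@filter_ex _ U).
  have n0 : 0 < n.+1%:R^-1 :> R by rewrite invr_gt0.
  have geU : U [set k | (n <= k)%N] by apply: ooU; exact: nbhs_infty_ge.
  have rU : U [set k | `|r - `|y k| | < n.+1%:R^-1].
    by move/cvgrPdist_lt : yr; exact.
  have lU c : U [set k | `|l c v - l c (y k)| < n.+1%:R^-1].
    by have /cvgrPdist_lt := yv _ (ld c); exact.
  by apply: filterS (filterI (filterI geU rU) (filter_pickle_lt _ lU n)) => k [[]].
have inv0 (e : R) : 0 < e -> \forall n \near \oo, n.+1%:R^-1 < e.
  by move=> e0; exact: near_infty_natSinv_lt (PosNum e0).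
exists s, v, r; split=> [n||]; first by have [] := sP n.
(* If [m] fails to converge along [s], an ultrafilter [G] carried by the bad indices yields a weak
   limit [w] of [y \o s]. All [l c] agree at [w] and [v], so [w = v], which is absurd on the bad
   indices. *)
- move=> m md; apply/cvgrPdist_lt => e e0; apply: contrapT => nearN.
  pose B := [set n | e <= `|m v - m (y (s n))|].
  have PB : ProperFilter (within B \oo).
    split; last by apply: within_filter.
    move=> B0; have {}B0 : \forall n \near \oo, B n -> False by exact: B0.
    apply: nearN; apply: filterS B0 => n; rewrite /B/=.
    by rewrite ltNge => nB; apply/negP => eB; exact: nB.
  have [G [UG BG]] := ultraFilterLemma PB.
  have PG : ProperFilter G by exact: ultra_proper.
  have ooG : \oo `<=` G by move=> A ooA; apply: BG; apply: filterS ooA.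
  have GB : G B by apply: BG; exact: withinT.
  have [w yw] := reflexive_ultra_cvg UG rX (fun n => yM (s n)).
  have vw0 : w - v = 0.
    apply: (norming_separates (y := y) ld lb ln) => [p pd py|c].
      have [pl _] := pd; rewrite linear_funB//.
      suff -> : p w = 0.
        suff -> : p v = 0 by rewrite subrr.
        have := yv p pd; under eq_fun do rewrite py.
        by move/(norm_cvg_unique (cvg_cst 0)) => <-.
      have := yw p pd; under eq_fun do rewrite py.
      by move/(norm_cvg_unique (cvg_cst 0)) => <-.
    have [cl _] := ld c; rewrite linear_funB//; apply/eqP; rewrite subr_eq0.
    apply/eqP/(norm_cvg_unique (yw _ (ld c))).
    apply/cvgrPdist_lt => d d0; apply: ooG; near=> n.
    have [_ lcn _] := sP n; apply: lt_trans (lcn c _) _.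
      by near: n; exact: nbhs_infty_gt.
    by near: n; exact: inv0.
  have := yw m md => /cvgrPdist_lt/(_ e e0) Gm.
  have [n [eB]] := filter_ex (filterI GB Gm) => /=.
  by move/subr0_eq : vw0 => ->; rewrite ltNge eB.
- apply/cvgrPdist_lt => e e0; near=> n.
  have [_ _ rn] := sP n; apply: lt_trans rn _.
  by near: n; exact: inv0.
Unshelve. all: by end_near. Qed.

(** * Duality maps *)

(** Evaluation at [w] pulls [A] back to a subbasic entourage, which counts as a finite intersection
    of such. *)
Lemma ptws_entourage (U : Type) (V : uniformType) (w : U) (A : set (V * V)) :
  entourage A -> @entourage {ptws U -> V} [set p | A (p.1 w, p.2 w)].
Proof.
move=> eA.
have eW : @entourage (initial_topology (@proj U (fun=> V) w))
    [set p | A (p.1 w, p.2 w)] by exists A.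
exists [set p | A (p.1 w, p.2 w)] => //.
set f := (X in finI_from _ X _).
by have := @finI_from1 _ _ setT f (exist _ (w, _) (asboolT eW)) I.
Qed.

Lemma ptws_cvg_eval (R : realType) (X : normedModType R) (u : nat -> X)
    (j : X -> {ptws X -> R^o}) (l : {ptws X -> R^o}) (w : X) :
  j (u n) @[n --> \oo] --> l -> j (u n) w @[n --> \oo] --> l w.
Proof.
move=> jl; have := @pointwise_cvgP X R^o (j (u n) @[n --> \oo]) l _.
by move=> [/(_ jl w)].
Qed.

(* Both kinds of B spaces carry such a [j]; the rest of the proof uses nothing
   else about the space. *)
Definition unif_duality (R : realType) (X : normedModType R)
    (j : X -> X -> R^o) : Prop :=
  [/\ forall x, linear (j x), forall x, j x x = `|x| ^+ 2,
      forall x v, `|j x v| <= `|x| * `|v|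
    & forall w (M e : R), 0 < e -> exists2 d, 0 < d & forall x y,
        `|x| <= M -> `|y| <= M -> `|x - y| < d -> `|j x w - j y w| < e].

Lemma unif_duality_weakstar (R : realType) (X : normedModType R)
    (j : X -> {ptws X -> R^o}) :
  (forall x, duality_map x = [set j x]) ->
  unif_norm_to_weakstar_on_bounded j -> unif_duality j.
Proof.
move=> jP junif.
have jD x : duality_map x (j x) by rewrite jP.
split=> [x|x|x v|w M e e0].
- by have [[]] := jD x.
- by have [] := jD x.
- have [jd _ jn] := jD x.
  suff -> : `|x| = dual_norm (j x) by exact: dual_normP.
  by apply/eqP; rewrite -(@eqrXn2 _ 2) ?dual_norm_ge0//; apply/eqP.
have bM : [bounded x | x in [set x : X | `|x| <= M]].
  by exists M; split; [exact: num_real|move=> N MN x /= xM; exact: le_trans (ltW MN)].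
have eE := ptws_entourage w (entourage_ball (R^o) (PosNum e0)).
have : @entourage X [set p | `|p.1| <= M -> `|p.2| <= M ->
    ball (j p.1 w : R^o) e (j p.2 w)] by exact: junif bM _ eE.
rewrite -entourage_ballE => -[d d0 dP]; exists d => // x y xM yM xy.
by apply: (dP (x, y)) => //=; rewrite -ball_normE.
Qed.

Section Gauge.
Context {R : realType} {X : normedModType R} (phi : R -> R).
Hypothesis phi_gauge : gauge_function phi.
Context (j : X -> {ptws X -> R^o}).
Hypothesis jP : forall x, duality_map_gauge phi x = [set j x].

(* At [x = 0] the ratio is [0 / 0 = 0], which gives the right functional. *)
Definition normalized (x v : X) : R^o := `|x| / phi `|x| * j x v.

Let jD x : duality_map_gauge phi x (j x).
Proof. by rewrite jP. Qed.

Let phi_gt0 t : 0 < t -> 0 < phi t.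
Proof. by have [_ _ /(_ 0 t (lexx _)) + phi0 _] := phi_gauge; rewrite phi0. Qed.

Let normalized_bound x v : `|normalized x v| <= `|x| * `|v|.
Proof.
rewrite /normalized; have [->|x0] := eqVneq x 0.
  by rewrite normr0 !mul0r normr0.
have nx0 : 0 < `|x| by rewrite normr_gt0.
have p0 := phi_gt0 nx0.
have [jd _ jn] := jD x; have := dual_normP v jd; rewrite jn.
move=> jb; have c0 : 0 <= `|x| / phi `|x| by rewrite divr_ge0// ltW.
by rewrite normrM (ger0_norm c0) mulrAC ler_pdivrMr// -mulrA ler_pM2l// mulrC.
Qed.

(** For fixed [w], the limit depends only on the weak limit [v] and the limit norm [r]. If [r = 0],
    the norm bound forces it to be 0; if [r > 0], the ratio converges because [phi] is continuous
    and positive at [r]. *)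
Let normalized_weak_cvg (u : nat -> X) v (r : R) w :
  weak_to_weakstar_seq_continuous j -> weak_cvg u v ->
  `|u n| @[n --> \oo] --> r ->
  normalized (u n) w @[n --> \oo] -->
    (if r == 0 then 0 else r / phi r * j v w : R^o).
Proof.
move=> jw uv ur; case: eqP => [r0|/eqP r0].
  apply/norm_cvg0P; apply: (squeeze_cvgr (f := fun=> 0) (h := fun n => `|u n| * `|w|)).
  - by apply: nearW => n; rewrite normr_ge0 normalized_bound.
  - exact: cvg_cst.
  - by rewrite -(mul0r `|w|) -r0; apply: cvgM => //; exact: cvg_cst.
have rge0 : 0 <= r by apply: cvgr_to_ge ur _; exact: nearW.
have rgt0 : 0 < r by rewrite lt_def r0.
have phir : phi `|u n| @[n --> \oo] --> phi r.
  (* Continuity of [phi] holds within the half-line, where all norms lie. *)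
  have [_ /subspace_continuousP/(_ r rge0) phic _ _ _] := phi_gauge.
  apply: cvg_trans phic => B /= rB; have := ur _ rB.
  by apply: (@filterS _ \oo) => n /=; apply => /=.
have ratio : `|u n| / phi `|u n| @[n --> \oo] --> r / phi r.
  exact: cvgM ur (cvgV (lt0r_neq0 (phi_gt0 rgt0)) phir).
have jvw : (j (u n) w : R) @[n --> \oo] --> (j v w : R).
  exact: ptws_cvg_eval (jw _ _ uv).
exact: (cvgM ratio jvw).
Qed.

(* Otherwise some [x n - y n --> 0] keep [j (x n) w] and [j (y n) w] apart; but
   along a subsequence both have the same weak limit and the same limit norm. *)
Lemma unif_duality_gauge : reflexive_space X ->
  weak_to_weakstar_seq_continuous j -> unif_duality normalized.
Proof.
move=> rX jw; split=> [x|x|//|w M e e0].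
- have [[jl _] _ _] := jD x; move=> a u v.
  by rewrite /normalized jl mulrDr mulrCA.
- rewrite /normalized; have [->|x0] := eqVneq x 0.
    by rewrite normr0 !mul0r expr0n.
  have nx0 : 0 < `|x| by rewrite normr_gt0.
  have [_ -> _] := jD x; have := phi_gt0 nx0.
  by move=> p0; rewrite mulrA mulrAC divfK ?gt_eqF.
apply: contrapT => nod.
have /choice[xy xyP] n : exists p : X * X, [/\ `|p.1| <= M, `|p.2| <= M,
    `|p.1 - p.2| < n.+1%:R^-1 & e <= `|normalized p.1 w - normalized p.2 w|].
  apply: contrapT => nop; apply: nod; exists n.+1%:R^-1; first by rewrite invr_gt0.
  move=> x y xM yM xy; rewrite ltNge; apply/negP => exy.
  by apply: nop; exists (x, y).
have inv0 (d : R) : 0 < d -> \forall n \near \oo, n.+1%:R^-1 < d.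
  by move=> d0; exact: near_infty_natSinv_lt (PosNum d0).
pose x n := (xy n).1; pose y n := (xy n).2.
have xM n : `|x n| <= M by have [] := xyP n.
have [s [v [r [sn xv xr]]]] := reflexive_weak_subsequence rX xM.
have s_small d : 0 < d -> \forall n \near \oo, `|x (s n) - y (s n)| < d.
  move=> d0; near=> n; have [_ _ xyn _] := xyP (s n).
  apply: lt_trans xyn _; apply: le_lt_trans (_ : n.+1%:R^-1 < d).
    by rewrite lef_pV2 ?posrE// ler_nat ltnS.
  by near: n; exact: inv0.
have yr : `|y (s n)| @[n --> \oo] --> r.
  apply/cvgrPdist_lt => d d0; have d20 : 0 < d / 2 by lra.
  near=> n.
  have h1 : `|r - `|x (s n)| | < d / 2.
    by near: n; move/cvgrPdist_lt : xr; exact.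
  have h2 : `|x (s n) - y (s n)| < d / 2 by near: n; exact: s_small.
  have h3 := ler_dist_dist (x (s n)) (y (s n)).
  have := ler_normD (r - `|x (s n)|) (`|x (s n)| - `|y (s n)|).
  by rewrite addrA subrK; lra.
have yv : weak_cvg (y \o s) v.
  move=> l ld; have [K K0 lK] := dual_bounded ld.
  apply/cvgrPdist_lt => d d0; have d20 : 0 < d / 2 by lra.
  near=> n.
  have h1 : `|l v - l (x (s n))| < d / 2.
    by near: n; have /cvgrPdist_lt := xv _ ld; exact.
  have h2 : `|x (s n) - y (s n)| < d / 2 / K.
    by near: n; apply: s_small; rewrite divr_gt0.
  have h3 := lK (x (s n) - y (s n)); rewrite linear_funB in h3; last exact: ld.1.
  rewrite ltr_pdivlMr// mulrC in h2.
  have := ler_normD (l v - l (x (s n))) (l (x (s n)) - l (y (s n))).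
  by rewrite addrA subrK /=; lra.
have /cvgrPdist_lt cx := @normalized_weak_cvg _ _ _ w jw xv xr.
have /cvgrPdist_lt cy := @normalized_weak_cvg _ _ _ w jw yv yr.
have e20 : 0 < e / 2 by lra.
have [n [h1 h2]] := filter_ex (filterI (cx _ e20) (cy _ e20)).
have [_ _ _] := xyP (s n); rewrite -/(x _) -/(y _).
rewrite distrC/= in h1; rewrite /= in h2.
have := ler_normD (normalized (x (s n)) w - (if r == 0 then 0 else r / phi r * j v w))
  ((if r == 0 then 0 else r / phi r * j v w) - normalized (y (s n)) w).
by rewrite addrA subrK; lra.
Unshelve. all: by end_near. Qed.

End Gauge.

Lemma B_space_unif_duality (R : realType) (X : completeNormedModType R) :
  B_space X -> exists j : X -> X -> R^o, unif_duality j.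
Proof.
move=> [[j [jP ju]]|[rX [phi [gphi [j [jP jw]]]]]].
- by exists j; exact: unif_duality_weakstar.
- by exists (normalized phi j); exact: unif_duality_gauge.
Qed.

(** The subdifferential inequality of the squared norm: expand [j (x + y) (x + y)] linearly, bound
    the first term by [|x + y| * |x|] and use [2ab <= a^2 + b^2]. *)
Lemma unif_duality_sqr (R : realType) (X : normedModType R) (j : X -> X -> R^o)
    (x y : X) :
  unif_duality j -> `|x + y| ^+ 2 <= `|x| ^+ 2 + 2 * j (x + y) y.
Proof.
move=> [jl jx jb _].
have h : `|x + y| ^+ 2 = j (x + y) x + j (x + y) y.
  by rewrite -jx -linear_funD.
have h2 : j (x + y) x <= `|x + y| * `|x| by exact: le_trans (ler_norm _) (jb _ _).
have := sqr_ge0 (`|x + y| - `|x|); rewrite sqrrB.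
by move: h h2; rewrite -mulr_natl; lra.
Qed.

(** * Recursive inequalities *)

Section Xu.
Context {R : realType}.
Implicit Types g d s : nat -> R.

(* The shape [d <= o(g) + (a summable sequence)] covers both alternatives allowed
   for the increments of [a] and of [b]. *)
Definition negligible g d : Prop := exists2 delta : nat -> R,
  (forall n, 0 <= delta n) /\ cvgn (series delta) &
  forall e, 0 < e -> \forall n \near \oo, d n <= g n * e + delta n.

Lemma negligibleD g d d' :
  negligible g d -> negligible g d' -> negligible g (fun n => d n + d' n).
Proof.
move=> [dl [dl0 dlc] gd] [dl' [dl'0 dl'c] gd']; exists (dl + dl').
  split=> [n|]; first by rewrite /= addr_ge0.
  by rewrite seriesD; exact: is_cvgD.
move=> e e0; have e20 : 0 < e / 2 by lra.
have := gd' _ e20; have := gd _ e20; apply: filterS2 => n h h'.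
have -> : (dl + dl') n = dl n + dl' n by [].
by rewrite [in leRHS](splitr e) mulrDr; lra.
Qed.

Lemma negligibleZ g d (c : R) :
  0 < c -> negligible g d -> negligible g (fun n => c * d n).
Proof.
move=> c0 [dl [dl0 dlc] gd]; exists (c *: dl).
  split=> [n|]; first by apply: mulr_ge0 => //; exact: ltW.
  by rewrite seriesZ; exact: is_cvgZl_tmp.
move=> e e0; have ec0 : 0 < e / c by rewrite divr_gt0.
have := gd _ ec0; apply: filterS => n h.
have -> : (c *: dl) n = c * dl n by [].
apply: le_trans (ler_wpM2l (ltW c0) h) _.
by rewrite mulrDr mulrCA [c * (_ / _)]mulrC divfK// gt_eqF.
Qed.

Lemma negligible_weight g d (c : R) :
  0 < c -> negligible g d -> negligible (fun n => c * g n) d.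
Proof.
move=> c0 [dl dlP gd]; exists dl => // e e0.
by have := gd _ (mulr_gt0 c0 e0); apply: filterS => n; rewrite mulrA [g n * c]mulrC.
Qed.

Lemma negligible_summable g d : (forall n, 0 <= g n) -> (forall n, 0 <= d n) ->
  cvgn (series d) -> negligible g d.
Proof.
by move=> g0 d0 dc; exists d => // e e0; apply: nearW => n; rewrite lerDr mulr_ge0// ltW.
Qed.

Lemma negligible_littleo g d :
  (forall e, 0 < e -> \forall n \near \oo, d n <= g n * e) -> negligible g d.
Proof.
move=> h; exists (fun=> 0).
  split=> //; rewrite (_ : series _ = fun=> 0); first exact: is_cvg_cst.
  by apply/funext => n; rewrite /series/= big1.
by move=> e /h; apply: filterS => n; rewrite addr0.
Qed.

(** Past some [N], [s n] is bounded by three parts: the level [e / 3] allowed by the [o(g)] term, a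
    tail of the convergent series, and [s N] damped by the divergence of [series g]. This serves for
    the increments and for the squared distances. *)
Theorem xu_cvg0 g d s :
  (forall n, 0 <= g n <= 1) -> series g @ \oo --> +oo ->
  (forall n, 0 <= s n) -> (forall n, s n.+1 <= (1 - g n) * s n + d n) ->
  negligible g d -> s n @[n --> \oo] --> 0.
Proof.
move=> g01 gdiv s0 sS [dl [dl0 dlc] gd].
pose L := limn (series dl).
have dlL n : series dl n <= L.
  apply: nondecreasing_cvgn_le => //; apply/nondecreasing_seqP => m.
  by rewrite seriesSr lerDl.
apply/cvgrPdist_le => e e0.
have e30 : 0 < e / 3 by lra.
have [N1 _ h1] := gd _ e30.
have /cvgrPdist_le/(_ _ e30)[N2 _ h2] := dlc.
pose N := maxn N1 N2.
have dN n : (N <= n)%N -> d n <= g n * (e / 3) + dl n.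
  by move=> Nn; apply: h1 => /=; rewrite (leq_trans _ Nn)// leq_maxl.
have LN : L - series dl N <= e / 3.
  by apply: le_trans (ler_norm _) _; apply: h2 => /=; rewrite leq_maxr.
have g_ge n k : series g n <= series g (n + k)%N.
  elim: k => [|k IH]; first by rewrite addn0.
  rewrite addnS seriesSr; apply: le_trans IH _.
  by rewrite lerDl; have /andP[] := g01 (n + k)%N.
(* The last term comes from [prod (1 - g k) <= 1 / (1 + sum g k)]. *)
have bound k : s (N + k)%N <= e / 3 + (series dl (N + k)%N - series dl N) +
    s N / (1 + (series g (N + k)%N - series g N)).
  elim: k => [|k IH]; first by rewrite addn0 !subrr !addr0 divr1; lra.
  rewrite addnS !seriesSr.
  set n := (N + k)%N in IH *.
  have /andP[g0 g1] := g01 n.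
  have S0 : 0 <= series g n - series g N by rewrite subr_ge0 g_ge.
  have D0 : 0 <= series dl n - series dl N.
    rewrite subr_ge0; apply: (nondecreasing_seqP (series dl)).1; last exact: leq_addr.
    by move=> m; rewrite seriesSr lerDl.
  have step : (1 - g n) * s n <= (1 - g n) * (e / 3 +
      (series dl n - series dl N) + s N / (1 + (series g n - series g N))).
    by rewrite ler_wpM2l// subr_ge0.
  (* With [S] the sum so far, this amounts to [(1 - g n) * (1 + S + g n) <= 1 + S]. *)
  have frac : (1 - g n) * (s N / (1 + (series g n - series g N))) <=
      s N / (1 + (series g n + g n - series g N)).
    rewrite mulrA [_ * s N]mulrC -mulrA ler_wpM2l//.
    set S := series g n - series g N in S0 *.
    have -> : series g n + g n - series g N = S + g n by rewrite addrAC.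
    rewrite ler_pdivrMr; last by lra.
    rewrite ler_pdivlMl; last by lra.
    by nra.
  have := sS n; have := dN n (leq_addr _ _).
  have := mulr_ge0 g0 D0.
  by nra.
have [K hK] : exists K, forall n, (K <= n)%N ->
    s N / (1 + (series g n - series g N)) <= e / 3.
  have /cvgryPge/(_ (series g N + s N / (e / 3)))[K _ hK] := gdiv.
  exists K => n Kn; have := hK n Kn => /= hn.
  have : 0 <= s N / (e / 3) by rewrite divr_ge0// ltW.
  move=> q0; rewrite ler_pdivrMr; last by lra.
  rewrite mulrC -ler_pdivrMr//; lra.
exists (maxn N K) => // n /=; rewrite geq_max => /andP[Nn Kn].
rewrite sub0r normrN ger0_norm//.
have := bound (n - N)%N; rewrite subnKC// => bn.
by have := hK n Kn; have := dlL n; lra.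
Qed.

End Xu.

(** * The approximating path *)

Lemma conv_same (R : pzRingType) (V : lmodType R) (r : R) (u : V) :
  r *: u + (1 - r) *: u = u.
Proof. by rewrite -scalerDl addrC subrK scale1r. Qed.

(** The motion of the points is separated from the change of coefficient; the last term vanishes for
    [r = r'], and [conv_same] puts a single point in this form. *)
Lemma conv_sub (R : pzRingType) (V : lmodType R) (r r' : R) (u v u' v' : V) :
  r' *: u' + (1 - r') *: v' - (r *: u + (1 - r) *: v) =
  r' *: (u' - u) + (1 - r') *: (v' - v) + (r' - r) *: (u - v).
Proof.
have E s (a c : V) : s *: a + (1 - s) *: c = s *: (a - c) + c.
  by rewrite scalerBl scale1r scalerBr addrA addrAC.
have K : u' - v' = (u' - u) - (v' - v) + (u - v).
  by rewrite [RHS]addrAC addrA subrK opprB addrA subrK.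
have D (a b c w z : V) : a + b + w - (c + z) = a + (w - z) + (b - c).
  by rewrite opprD addrACA -[a + b - c]addrA addrAC.
by rewrite !E K scalerDr D scalerBl.
Qed.

Lemma norm_conv_sub (R : numDomainType) (V : normedModType R) (r r' : R)
    (u v u' v' : V) : 0 <= r' <= 1 ->
  `|r' *: u' + (1 - r') *: v' - (r *: u + (1 - r) *: v)| <=
  r' * `|u' - u| + (1 - r') * `|v' - v| + `|r' - r| * `|u - v|.
Proof.
move=> /andP[r0 r1]; rewrite conv_sub.
apply: le_trans (ler_normD _ _) _; rewrite normrZ lerD2r.
apply: le_trans (ler_normD _ _) _.
by rewrite !normrZ !ger0_norm// subr_ge0.
Qed.

Section Path.
Context {R : realType} {X : completeNormedModType R} (C : set X).
Hypothesis C_closed : closed C.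
Hypothesis C_convex : convex_set (C : set (convex_lmodType X)).
Context (T : X -> X).
Hypothesis TC : forall x, C x -> C (T x).
Hypothesis T_nexp : forall x y, C x -> C y -> `|T x - T y| <= `|x - y|.

Lemma convex_conv u v (t : R) : 0 <= t <= 1 -> C u -> C v ->
  C (t *: u + (1 - t) *: v).
Proof.
move=> /andP[t0 t1] Cu Cv.
have := @C_convex u v (Itv01 t0 t1) (mem_set Cu) (mem_set Cv).
by move/set_mem.
Qed.

Lemma contraction_fixed_point (g : X -> X) (k : R) :
  0 <= k < 1 -> C !=set0 -> (forall x, C x -> C (g x)) ->
  (forall x y, C x -> C y -> `|g x - g y| <= k * `|x - y|) ->
  exists2 p, C p & g p = p.
Proof.
move=> /andP[k0 k1] C0 gC g_k.
pose G : {fun C >-> C} := HB.pack g (isFun.Build X X C C g gC).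
have Gk : is_contraction G.
  exists (NngNum k0); split=> // -[x y] /= [Cx Cy]; exact: g_k.
by have [p Cp] := banach_fixed_point Gk C_closed C0; exists p.
Qed.

Lemma zpathP u t : C u -> 0 < t < 1 ->
  C (zpath C T u t) /\ t *: u + (1 - t) *: T (zpath C T u t) = zpath C T u t.
Proof.
move=> Cu /andP[t0 t1].
have t01 : 0 <= t <= 1 by rewrite !ltW.
have [||x Cx|x y Cx Cy|p Cp fp] :=
  @contraction_fixed_point (fun x => t *: u + (1 - t) *: T x) (1 - t).
- by apply/andP; split; lra.
- by exists u.
- by apply: convex_conv => //; exact: TC.
- apply: le_trans (norm_conv_sub _ _ _ _ _ t01) _.
  rewrite !subrr !normr0 mulr0 mul0r add0r addr0 ler_wpM2l ?T_nexp//; lra.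
by have /(getPex)[] : Fix C (fun x => t *: u + (1 - t) *: T x) !=set0 by exists p.
Qed.

(** The distance is at most [t * |u - v|] plus [1 - t] times itself; subtract and divide by [t]. *)
Lemma zpath_nexp u v t : C u -> C v -> 0 < t < 1 ->
  `|zpath C T u t - zpath C T v t| <= `|u - v|.
Proof.
move=> Cu Cv t01; have [Czu zu] := zpathP Cu t01; have [Czv zv] := zpathP Cv t01.
have /andP[t0 t1] := t01; have t01' : 0 <= t <= 1 by rewrite !ltW.
have := norm_conv_sub t u (T (zpath C T u t)) v (T (zpath C T v t)) t01'.
rewrite zu zv subrr normr0 mul0r addr0 => h.
have := T_nexp Czv Czu; rewrite distrC [in leRHS]distrC => h2.
rewrite distrC [in leRHS]distrC.
have h3 : (1 - t) * `|T (zpath C T v t) - T (zpath C T u t)| <=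
    (1 - t) * `|zpath C T v t - zpath C T u t|.
  by rewrite ler_wpM2l//; [lra|rewrite distrC [in leRHS]distrC].
by rewrite -(ler_pM2l t0); lra.
Qed.

Hypothesis path_cvg : forall u, C u -> cvg (zpath C T u t @[t --> 0^'+]).

Lemma near_right01 : \forall t \near (0 : R)^'+, 0 < t < 1.
Proof.
near=> t; apply/andP; split; near: t.
- exact: nbhs_right_gt.
- by apply: nbhs_right_lt.
Unshelve. all: by end_near. Qed.

Lemma RT_near u e : C u -> 0 < e ->
  \forall t \near (0 : R)^'+, `|RT C T u - zpath C T u t| < e.
Proof. by move=> Cu e0; have /cvgrPdist_lt := path_cvg Cu; exact. Qed.

Lemma RT_mem u : C u -> C (RT C T u).
Proof.
move=> Cu; apply: (closed_cvg C C_closed) (path_cvg Cu).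
by apply: filterS near_right01 => t /(zpathP Cu)[].
Qed.

Lemma RT_nexp u v : C u -> C v -> `|RT C T u - RT C T v| <= `|u - v|.
Proof.
move=> Cu Cv.
have h : `|zpath C T u t - zpath C T v t| @[t --> 0^'+] --> `|RT C T u - RT C T v|.
  exact: cvg_norm (cvgB (path_cvg Cu) (path_cvg Cv)).
apply: (cvgr_to_le h).
by apply: filterS near_right01 => t; exact: zpath_nexp.
Qed.

(** Since [z_t - T z_t = t (u - T z_t)] with a bounded second factor, [z_t] is an approximate fixed
    point for small [t], and it is close to [r]. *)
Lemma RT_fixed u : C u -> T (RT C T u) = RT C T u.
Proof.
move=> Cu; have Cr := RT_mem Cu; set r := RT C T u in Cr *.
apply/eqP; rewrite -subr_eq0 -normr_le0; apply/ler_addgt0Pr => e e0.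
rewrite add0r; pose K := `|u - T r| + 1.
have K0 : 0 < K by rewrite ltr_wpDl.
have e40 : 0 < Num.min 1 (e / 4) by rewrite lt_min ltr01/=; lra.
have eK : 0 < e / 4 / K by rewrite !divr_gt0.
have [t [[t01 rz] tK]] := filter_ex (filterI (filterI near_right01 (RT_near Cu e40))
  (nbhs_right_lt eK)).
rewrite /= lt_min in rz; case/andP: rz => rz1 rze.
rewrite -/r in rz1 rze.
have [Cz zE] := zpathP Cu t01; set z := zpath C T u t in rz1 rze Cz zE.
have /andP[t0 t1] := t01.
have zT : z - T z = t *: (u - T z).
  by rewrite -{1}zE scalerBl scale1r scalerBr -addrA; congr (_ + _);
    rewrite addrAC subrr sub0r.
have nzT : `|z - T z| = t * `|u - T z| by rewrite zT normrZ gtr0_norm.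
have Trz := T_nexp Cr Cz.
have uTz : `|u - T z| <= K.
  have := ler_normD (u - T r) (T r - T z); rewrite addrA subrK.
  by rewrite /K; lra.
rewrite ltr_pdivlMr// in tK.
have := ler_wpM2l (ltW t0) uTz.
have := ler_normD (T r - T z) (T z - r); rewrite addrA subrK.
have := ler_normD (T z - z) (z - r); rewrite addrA subrK.
rewrite (distrC z r) (distrC (T z) z).
by lra.
Qed.

(** [RT C T] is nonexpansive, so composing it with [f] gives an [alpha]-contraction of [C];
    uniqueness of its fixed point yields the equality of sets in [is_Q]. *)
Lemma viscosity_point (f : X -> X) (alpha : R) : 0 < alpha < 1 -> C !=set0 ->
  (forall x, C x -> C (f x)) ->
  (forall x y, C x -> C y -> `|f x - f y| <= alpha * `|x - y|) ->
  exists2 q, is_Q C T f q & [/\ C q, T q = q & RT C T (f q) = q].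
Proof.
move=> /andP[al0 al1] C0 fC f_al.
have [||x Cx|x y Cx Cy|q Cq fq] :=
  @contraction_fixed_point (fun x => RT C T (f x)) alpha.
- by rewrite ltW.
- by [].
- by apply: RT_mem; exact: fC.
- by apply: le_trans (RT_nexp (fC _ Cx) (fC _ Cy)) _; exact: f_al.
have Tq : T q = q by rewrite -fq RT_fixed//; exact: fC.
exists q; last by [].
apply/seteqP; split=> [y [Cy fy]|y ->]; last by split.
apply/eqP; rewrite -subr_eq0 -normr_le0.
have := RT_nexp (fC _ Cy) (fC _ Cq); rewrite fy fq => h.
have := le_trans h (f_al _ _ Cy Cq); have := normr_ge0 (y - q).
by nra.
Qed.

End Path.

(** * The iteration *)

Section Iteration.
Context {R : realType} {X : completeNormedModType R} (C : set X).
Hypothesis C_closed : closed C.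
Hypothesis C_convex : convex_set (C : set (convex_lmodType X)).
Context (T f : X -> X) (alpha : R).
Hypothesis TC : forall x, C x -> C (T x).
Hypothesis T_nexp : forall x y, C x -> C y -> `|T x - T y| <= `|x - y|.
Hypothesis alpha01 : 0 < alpha < 1.
Hypothesis fC : forall x, C x -> C (f x).
Hypothesis f_ctr : forall x y, C x -> C y -> `|f x - f y| <= alpha * `|x - y|.
Hypothesis path_cvg : forall u, C u -> cvg (zpath C T u t @[t --> 0^'+]).
Context (a b : nat -> R).
Hypothesis a01 : forall n, 0 < a n < 1.
Hypothesis a_cvg0 : a n @[n --> \oo] --> (0 : R).
Hypothesis a_div : series a @ \oo --> +oo.
Hypothesis a_var : cvgn (series (fun n => `|a n.+1 - a n|)) \/
  a n.+1 / a n @[n --> \oo] --> (1 : R).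
Hypothesis b01 : forall n, 0 <= b n <= 1.
Hypothesis b_cvg0 : b n @[n --> \oo] --> (0 : R).
Hypothesis b_var : cvgn (series (fun n => `|b n.+1 - b n|)) \/
  `|b n.+1 - b n| / a n @[n --> \oo] --> (0 : R).
Context (x : nat -> X).
Hypothesis x0C : C (x 0%N).
Let y n := b n *: x n + (1 - b n) *: T (x n).
Hypothesis xS : forall n, x n.+1 = a n *: f (x n) + (1 - a n) *: y n.
Context (q : X).
Hypotheses (Cq : C q) (Tq : T q = q) (Rq : RT C T (f q) = q).
Context (j : X -> X -> R^o).
Hypothesis j_unif : unif_duality j.

Let a_gt0 n : 0 < a n. Proof. by have /andP[] := a01 n. Qed.
Let a_lt1 n : a n < 1. Proof. by have /andP[] := a01 n. Qed.
Let a01' n : 0 <= a n <= 1. Proof. by rewrite !ltW. Qed.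
Let al_gt0 : 0 < alpha. Proof. by have /andP[] := alpha01. Qed.
Let al_lt1 : alpha < 1. Proof. by have /andP[] := alpha01. Qed.

(** The contraction gained in one step, as [a n * alpha + (1 - a n) = 1 - weight n]. *)
Let weight n := (1 - alpha) * a n.

Let weight01 n : 0 <= weight n <= 1.
Proof.
have al0 := ltW al_gt0; have al1 := ltW al_lt1.
by rewrite mulr_ge0 ?subr_ge0 ?mulr_ile1 ?subr_ge0 ?gerBl// ltW.
Qed.

Let weight_div (g : nat -> R) : series g @ \oo --> +oo ->
  series (fun n => (1 - alpha) * g n) @ \oo --> +oo.
Proof.
move=> /cvgryPge gdiv; apply/cvgryPge => A.
have al0 : 0 < 1 - alpha by rewrite subr_gt0.
have := gdiv (A / (1 - alpha)); apply: filterS => n.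
by rewrite ler_pdivrMr// mulrC /series/= mulr_sumr.
Qed.

(** * Invariance and boundedness of the iterates *)

Let xC n : C (x n).
Proof.
elim: n => // n Cx; rewrite xS; apply: convex_conv => //; first exact: fC.
by apply: convex_conv => //; exact: TC.
Qed.

Let y_dist n : `|y n - q| <= `|x n - q|.
Proof.
rewrite -{1}(conv_same (b n) q) /y; apply: le_trans (norm_conv_sub _ _ _ _ _ (b01 n)) _.
rewrite !subrr !normr0 mulr0 addr0.
have := T_nexp (xC n) Cq; rewrite Tq => h; have /andP[_ b1] := b01 n.
have b1' : 0 <= 1 - b n by rewrite subr_ge0.
by have := ler_wpM2l b1' h; lra.
Qed.

Let step_dist n : `|a n *: (f (x n) - f q) + (1 - a n) *: (y n - q)| <=
  (1 - weight n) * `|x n - q|.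
Proof.
apply: le_trans (ler_normD _ _) _; rewrite !normrZ !ger0_norm; last first.
- by rewrite ltW.
- by rewrite subr_ge0 ltW.
have a1 : 0 <= 1 - a n by rewrite subr_ge0 ltW.
have := ler_wpM2l (ltW (a_gt0 n)) (f_ctr (xC n) Cq).
have := ler_wpM2l a1 (y_dist n).
by rewrite /weight; lra.
Qed.

(** The drift [f q - q] is isolated: the other summand contracts by [step_dist], and the drift will
    be paired with the duality map. *)
Let step_split n : x n.+1 - q =
  (a n *: (f (x n) - f q) + (1 - a n) *: (y n - q)) + a n *: (f q - q).
Proof.
rewrite xS -{1}(conv_same (a n) q) conv_sub !subrr scale0r addr0.
rewrite [RHS]addrAC; congr (_ + _); rewrite -scalerDr; congr (_ *: _).
by rewrite addrA subrK.
Qed.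

(** Chosen so that [|f q - q| <= (1 - alpha) * K], which keeps the iterates in the ball of radius
    [K] around [q]. *)
Let K := `|x 0%N - q| + `|f q - q| / (1 - alpha).

Let x_bounded n : `|x n - q| <= K.
Proof.
have al0 : 0 < 1 - alpha by rewrite subr_gt0.
have fK : `|f q - q| <= (1 - alpha) * K.
  rewrite /K mulrDr mulrCA divff ?gt_eqF// mulr1 lerDr.
  by rewrite mulr_ge0// ltW.
elim: n => [|n IH]; first by rewrite /K lerDl divr_ge0// ltW.
rewrite step_split; apply: le_trans (ler_normD _ _) _.
rewrite normrZ (gtr0_norm (a_gt0 n)).
have := step_dist n; have /andP[_ w1] := weight01 n.
have w0 : 0 <= 1 - weight n by rewrite subr_ge0.
have := ler_wpM2l w0 IH; have := ler_wpM2l (ltW (a_gt0 n)) fK.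
by rewrite /weight; lra.
Qed.

(** A common bound for the differences of [x n], [f (x n)], [y n] and [T (x n)]; the [+ 1] makes it
    positive in all cases. *)
Let M := 2 * K + `|f q - q| + 1.

Let K_ge0 : 0 <= K. Proof. exact: le_trans (x_bounded 0%N). Qed.

Let M_gt0 : 0 < M.
Proof. by rewrite /M; have := K_ge0; have := normr_ge0 (f q - q); lra. Qed.

Let Tx_bounded n : `|T (x n) - q| <= K.
Proof. by rewrite -{1}Tq; apply: le_trans (T_nexp (xC n) Cq) (x_bounded n). Qed.

Let fx_bounded n : `|f (x n) - q| <= K + `|f q - q|.
Proof.
have := ler_normD (f (x n) - f q) (f q - q); rewrite addrA subrK.
have := f_ctr (xC n) Cq; have := x_bounded n.
have := ltW al_lt1; have := normr_ge0 (x n - q); nra.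
Qed.

Let dist_center (u v : X) (r s : R) :
  `|u - q| <= r -> `|v - q| <= s -> `|u - v| <= r + s.
Proof.
move=> ur vs; have := ler_normD (u - q) (q - v); rewrite addrA subrK.
by rewrite (distrC q v); lra.
Qed.

Let xT_bounded n : `|x n - T (x n)| <= M.
Proof.
have := dist_center (x_bounded n) (Tx_bounded n).
by rewrite /M; have := normr_ge0 (f q - q); lra.
Qed.

Let fT_bounded n : `|f (x n) - T (x n)| <= M.
Proof. by have := dist_center (fx_bounded n) (Tx_bounded n); rewrite /M; lra. Qed.

Let fy_bounded n : `|f (x n) - y n| <= M.
Proof.
have := dist_center (fx_bounded n) (le_trans (y_dist n) (x_bounded n)).
by rewrite /M; lra.
Qed.

(** * Asymptotic regularity *)

Let increment n : `|x n.+2 - x n.+1| <= (1 - weight n.+1) * `|x n.+1 - x n| +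
  (M * `|a n.+1 - a n| + M * `|b n.+1 - b n|).
Proof.
rewrite (xS n.+1) (xS n).
(* Two nested convex combinations: the outer splitting pays for the change of [a], the inner one for
   the change of [b]. *)
apply: le_trans (norm_conv_sub _ _ _ _ _ (a01' n.+1)) _; rewrite -xS.
have yy : `|y n.+1 - y n| <= `|x n.+1 - x n| + M * `|b n.+1 - b n|.
  apply: le_trans (norm_conv_sub _ _ _ _ _ (b01 n.+1)) _.
  have /andP[_ b1] := b01 n.+1; have b1' : 0 <= 1 - b n.+1 by rewrite subr_ge0.
  have := ler_wpM2l b1' (T_nexp (xC n.+1) (xC n)).
  have := ler_wpM2l (normr_ge0 (b n.+1 - b n)) (xT_bounded n).
  by lra.
have a1 : 0 <= 1 - a n.+1 by rewrite subr_ge0 ltW.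
have := ler_wpM2l (ltW (a_gt0 n.+1)) (f_ctr (xC n.+1) (xC n)).
have := ler_wpM2l a1 yy.
have := ler_wpM2l (normr_ge0 (a n.+1 - a n)) (fy_bounded n).
have : 0 <= a n.+1 * (M * `|b n.+1 - b n|) by rewrite !mulr_ge0// ltW.
by rewrite /weight; lra.
Qed.

Let a_negligible : negligible (fun n => a n.+1) (fun n => `|a n.+1 - a n|).
Proof.
case: a_var => [ac|ar].
  by apply: negligible_summable => // n; exact: ltW.
apply: negligible_littleo => e e0.
(* The [1 / 2] ensures [a n <= 2 * a n.+1], which turns [e / 2 * a n] into [e * a n.+1]. *)
have d0 : 0 < Num.min (1 / 2) (e / 2) by rewrite lt_min; apply/andP; split; lra.
have /cvgrPdist_lt/(_ _ d0) := ar; apply: filterS => n.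
rewrite lt_min => /andP[r1 r2]; set r := a n.+1 / a n in r1 r2.
have ra : a n.+1 = r * a n by rewrite divfK// gt_eqF.
have -> : `|a n.+1 - a n| = `|1 - r| * a n.
  by rewrite ra -{2}(mul1r (a n)) -mulrBl normrM distrC (gtr0_norm (a_gt0 n)).
rewrite ra mulrAC ler_pM2r//.
have : 1 / 2 < r by have := ler_norm (1 - r); lra.
by nra.
Qed.

(** The second alternative compares with [a n], while the weight is [a n.+1]; [a_negligible] with
    [e = 1] gives [a n <= 2 * a n.+1 + dl n] eventually. *)
Let b_negligible : negligible (fun n => a n.+1) (fun n => `|b n.+1 - b n|).
Proof.
case: b_var => [bc|br].
  by apply: negligible_summable => // n; exact: ltW.
have [dl dlP aP] := a_negligible; exists dl => // e e0.
(* In the minimum, [1] keeps the coefficient of [dl n] at most 1, and [e / 2] absorbs the factor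
   2. *)
have d0 : 0 < Num.min 1 (e / 2) by rewrite lt_min; apply/andP; split; lra.
have /cvgrPdist_lt/(_ _ d0) := br; have := aP 1 ltr01.
apply: filterS2 => n; rewrite mulr1 => aa.
rewrite sub0r normrN ger0_norm; last by rewrite divr_ge0// ltW.
rewrite lt_min ltr_pdivrMr// mul1r ltr_pdivrMr// => /andP[b1 b2].
have := dlP.1 n; have := a_gt0 n.+1; have := a_gt0 n.
have := ler_norm (- (a n.+1 - a n)); rewrite normrN opprB.
have [e1|e1] := leP (e / 2) 1; nra.
Qed.

Let increments_cvg0 : `|x n.+1 - x n| @[n --> \oo] --> 0.
Proof.
have al0 : 0 < 1 - alpha by rewrite subr_gt0.
apply: (xu_cvg0 (g := fun n => weight n.+1)
  (d := fun n => M * `|a n.+1 - a n| + M * `|b n.+1 - b n|)) => //.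
- apply: (weight_div (g := fun n => a n.+1)); apply/cvgryPge => A.
  (* The shifted series lacks the term [a 0], which is below 1. *)
  have /cvgryPge/(_ (1 + A))[N _ hN] := a_div; exists N => // n /= Nn.
  have := hN n.+1 (leqW Nn).
  rewrite /series/= big_nat_recl// => h.
  by rewrite -(lerD2l 1) (le_trans h)// lerD2r ltW.
- by apply: negligible_weight => //; apply: negligibleD; exact: negligibleZ.
Qed.

(** [x n.+1] is close to [T (x n)] because [a n] and [b n] tend to 0, and close to [x n] by
    [increments_cvg0]. *)
Let residual_cvg0 : `|x n - T (x n)| @[n --> \oo] --> 0.
Proof.
have up n : `|x n - T (x n)| <= `|x n.+1 - x n| + (a n * M + b n * M).
  have := ler_normD (x n - x n.+1) (x n.+1 - T (x n)); rewrite addrA subrK.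
  rewrite (distrC (x n) (x n.+1)).
  suff : `|x n.+1 - T (x n)| <= a n * M + b n * M by lra.
  rewrite xS -{1}(conv_same (a n) (T (x n))).
  apply: le_trans (norm_conv_sub _ _ _ _ _ (a01' n)) _.
  rewrite !subrr !normr0 mul0r addr0.
  have yT : `|y n - T (x n)| <= b n * `|x n - T (x n)|.
    rewrite -{1}(conv_same (b n) (T (x n))).
    apply: le_trans (norm_conv_sub _ _ _ _ _ (b01 n)) _.
    by rewrite !subrr !normr0 mul0r mulr0 !addr0.
  have /andP[b0 _] := b01 n.
  have := ler_wpM2l (ltW (a_gt0 n)) (fT_bounded n).
  have := ler_wpM2l b0 (xT_bounded n); have := normr_ge0 (y n - T (x n)).
  have := a_gt0 n; have := a_lt1 n; nra.
apply: (squeeze_cvgr (f := fun=> 0)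
  (h := fun n => `|x n.+1 - x n| + (a n * M + b n * M))).
- by apply: nearW => n; rewrite normr_ge0 up.
- exact: cvg_cst.
- rewrite [X in _ --> X](_ : 0 = 0 + (0 * M + 0 * M)); last by rewrite !mul0r !addr0.
  apply: cvgD => //; apply: cvgD; (apply: cvgM => //; exact: cvg_cst).
Qed.

(* The points [z_t] of the path are approximate solutions of the variational
   inequality along [x], with an error [O(t) + o(1) / t]; let [n], then [t],
   tend to their limits. *)
Let limsup_le0 (e : R) : 0 < e ->
  \forall n \near \oo, j (x n - q) (f q - q) <= e.
Proof.
move=> e0; have [jl jx jb ju] := j_unif.
(* [L] bounds both [x n - q] and [x n - z] once [|q - z| < 1]. *)
pose L := K + 1; have L0 : 0 < L by rewrite /L; have := K_ge0; lra.
have e40 : 0 < e / 4 by lra.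
have [d d0 dP] := ju (f q - q) L _ e40.
(* Closeness of [z] to [q] is used three times: [d] to move the argument of [j], [1] for the bound
   [L], and [e / 4 / L] to replace [f q - z] by [f q - q]. *)
have r0 : 0 < Num.min (Num.min d 1) (e / 4 / L).
  by rewrite !lt_min d0 ltr01/= divr_gt0.
(* This bound on [t] and the later one on [w] each contribute at most [t * e / 2] to the estimate of
   [2 * t * J]. *)
have t0' : 0 < e / 2 / (L * L) by rewrite !divr_gt0 ?mulr_gt0//; lra.
have Cf := fC Cq.
have [t [[t01 qz] tL]] := filter_ex (filterI (filterI near_right01
  (RT_near path_cvg Cf r0)) (nbhs_right_lt t0')).
have [Cz zE] := zpathP C_closed C_convex TC T_nexp Cf t01.
rewrite Rq in qz; set z := zpath C T (f q) t in qz Cz zE.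
rewrite !lt_min/= in qz; case/andP: qz => /andP[qzd qz1] qze.
have /andP[t0 t1] := t01.
rewrite ltr_pdivlMr ?mulr_gt0// in tL; rewrite ltr_pdivlMr// in qze.
have w0 : 0 < Num.min 1 (t * e / 2 / (2 * L + 1)).
  by rewrite lt_min ltr01/= !divr_gt0 ?mulr_gt0//; lra.
have /cvgrPdist_lt/(_ _ w0) := residual_cvg0; apply: filterS => n.
rewrite sub0r normrN normr_id lt_min => /andP[w1 wt].
set w := `|x n - T (x n)| in w1 wt.
rewrite ltr_pdivlMr in wt; last by lra.
set D := `|x n - z|.
have DL : D <= L.
  have := ler_normD (x n - q) (q - z); rewrite addrA subrK -/D.
  by have := x_bounded n; rewrite /L; lra.
have w_ge0 : 0 <= w by exact: normr_ge0.
have D_ge0 : 0 <= D by exact: normr_ge0.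
have xTz : `|x n - T z| <= D + w.
  have := ler_normD (x n - T (x n)) (T (x n) - T z); rewrite addrA subrK.
  by have := T_nexp (xC n) Cz; rewrite -/w -/D; lra.
have split_xz : x n - z = (1 - t) *: (x n - T z) + t *: (x n - f q).
  rewrite -{1}zE -{1}(conv_same t (x n)) conv_sub !subrr scale0r addr0.
  by rewrite addrC.
have := unif_duality_sqr ((1 - t) *: (x n - T z)) (t *: (x n - f q)) j_unif.
rewrite -split_xz -/D normrZ (linear_funZ _ _ (jl _)).
(* In this form [j (x n - z)] meets [x n - z] itself and produces [D ^+ 2]. *)
rewrite (_ : x n - f q = (x n - z) - (f q - z)); last first.
  by rewrite opprB addrA subrK.
rewrite (linear_funB _ _ (jl _)) jx -/D ger0_norm; last by rewrite subr_ge0 ltW.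
set J := j (x n - z) (f q - z) => main.
have sq : ((1 - t) * `|x n - T z|) ^+ 2 <= ((1 - t) * (D + w)) ^+ 2.
  have t1' : 0 <= 1 - t by rewrite subr_ge0 ltW.
  apply: lerXn2r; last by rewrite ler_wpM2l.
    by rewrite nnegrE mulr_ge0.
  by rewrite nnegrE mulr_ge0// addr_ge0.
(* As [(1 - t)^2 = 1 - 2t + t^2], the terms [D^2] and [2 t D^2] cancel and only [t^2 D^2] is
   left. *)
have tJ : 2 * t * J <= t * t * (L * L) + (2 * L + 1) * w.
  have DD : D * D <= L * L by rewrite ler_pM.
  have ww : w * w <= w by rewrite ler_piMl// ltW.
  have Dw : D * w <= L * w by rewrite ler_wpM2r.
  have tt : (1 - t) ^+ 2 <= 1 by rewrite exprn_ile1//; lra.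
  have E0 : 0 <= 2 * (D * w) + w * w by rewrite addr_ge0 ?mulr_ge0.
  have := ler_wpM2r E0 tt.
  have := ler_wpM2l (mulr_ge0 (ltW t0) (ltW t0)) DD.
  move: main sq; rewrite !expr2; nra.
have J2 : J <= e / 2.
  rewrite -(ler_pM2l t0); have := ler_wpM2l (ltW t0) (ltW tL).
  by nra.
have jq : j (x n - z) (f q - q) <= J + e / 4.
  rewrite (_ : f q - q = (f q - z) - (q - z)); last first.
    by rewrite opprB addrA subrK.
  rewrite (linear_funB _ _ (jl _)) -/J.
  have := le_trans (ler_norm _) (jb (x n - z) (- (q - z))).
  rewrite (linear_funN _ (jl _)) normrN -/D.
  have := normr_ge0 (q - z); nra.
have : `|j (x n - q) (f q - q) - j (x n - z) (f q - q)| < e / 4.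
  apply: dP => //; first by have := x_bounded n; rewrite /L; lra.
  by rewrite opprB addrC addrA subrK distrC.
have := ler_norm (j (x n - q) (f q - q) - j (x n - z) (f q - q)).
by lra.
Qed.

Lemma viscosity_iteration_cvg : x n @[n --> \oo] --> q.
Proof.
have al0 : 0 < 1 - alpha by rewrite subr_gt0.
have sq_cvg : `|x n - q| ^+ 2 @[n --> \oo] --> 0.
  (* [d] may be negative here; the one-sided bound of [limsup_le0] makes it negligible with respect
     to [a]. *)
  apply: (xu_cvg0 (g := weight)
    (d := fun n => 2 * (a n * j (x n.+1 - q) (f q - q)))) => //.
  - exact: (weight_div a_div).
  - move=> n; have := unif_duality_sqr
      (a n *: (f (x n) - f q) + (1 - a n) *: (y n - q)) (a n *: (f q - q)) j_unif.
    rewrite -step_split; have [jl _ _ _] := j_unif.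
    rewrite (linear_funZ _ _ (jl _)).
    have /andP[w0 w1] := weight01 n; have sd := step_dist n.
    set A := `|_ + _ *: _| in sd *.
    have A2 : A ^+ 2 <= ((1 - weight n) * `|x n - q|) ^+ 2.
      apply: lerXn2r => //; first by rewrite nnegrE; exact: normr_ge0.
      by rewrite nnegrE mulr_ge0// subr_ge0.
    have : ((1 - weight n) * `|x n - q|) ^+ 2 <= (1 - weight n) * `|x n - q| ^+ 2.
      rewrite exprMn ler_wpM2r ?exprn_ge0// expr2 ler_piMr ?subr_ge0//; lra.
    by lra.
  - apply: negligible_weight => //; apply: negligibleZ => //.
    apply: negligible_littleo => e e0.
    have [N _ hN] := limsup_le0 e0; exists N => // n /= Nn.
    by rewrite (ler_wpM2l (ltW (a_gt0 n)))//; apply: hN; exact: leqW.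
apply/cvgrPdist_lt => e e0.
have e20 : 0 < e ^+ 2 by rewrite exprn_gt0.
have /cvgrPdist_lt/(_ _ e20) := sq_cvg; apply: filterS => n.
rewrite sub0r normrN normrX normr_id (distrC q) => h; rewrite ltNge.
apply/negP => h'; move: h; rewrite ltNge => /negP; apply.
by apply: lerXn2r; rewrite ?nnegrE// ltW.
Qed.

End Iteration.

Theorem theorem13 (R : realType) (X : completeNormedModType R) (HX : B_space X)
  (C : set X) (C0 : C !=set0) (Ccl : closed C)
  (Ccv : convex_set (C : set (convex_lmodType X)))
  (T : {fun C >-> C}) (Tne : 1.-lipschitz_C T) (FixT : Fix C T !=set0)
  (* the limit defining R_T exists at every point of C *)
  (HRT : forall u, C u -> cvg (zpath C T u t @[t --> 0^'+]))
  (alpha : R) (alpha01 : 0 < alpha < 1)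
  (f : {fun C >-> C}) (fctr : alpha.-lipschitz_C f)
  (a : nat -> R)
  (a01 : forall n, 0 < a n < 1)
  (a_cvg0 : a n @[n --> \oo] --> (0 : R))
  (a_div : series a @ \oo --> +oo)
  (a_var : cvgn (series (fun n => `|a n.+1 - a n|)) \/
           a n.+1 / a n @[n --> \oo] --> (1 : R))
  (b : nat -> R)
  (b01 : forall n, 0 <= b n <= 1)
  (b_cvg0 : b n @[n --> \oo] --> (0 : R))
  (b_var : cvgn (series (fun n => `|b n.+1 - b n|)) \/
           `|b n.+1 - b n| / a n @[n --> \oo] --> (0 : R))
  (x : nat -> X) (x0C : C (x 0%N))
  (xS : forall n, x n.+1 =
     a n *: f (x n) + (1 - a n) *: (b n *: x n + (1 - b n) *: T (x n))) :
  exists q : X, is_Q C T f q /\ x n @[n --> \oo] --> q.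
Proof.
have TC u : C u -> C (T u) by exact: funS.
have fC u : C u -> C (f u) by exact: funS.
have T_nexp u v : C u -> C v -> `|T u - T v| <= `|u - v|.
  by move=> Cu Cv; have := Tne (u, v) (conj Cu Cv); rewrite /= mul1r.
have f_ctr u v : C u -> C v -> `|f u - f v| <= alpha * `|u - v|.
  by move=> Cu Cv; exact: (fctr (u, v) (conj Cu Cv)).
have [q qQ [Cq Tq Rq]] :=
  viscosity_point Ccl Ccv TC T_nexp HRT alpha01 C0 fC f_ctr.
have [j jP] := B_space_unif_duality HX.
exists q; split=> //.
exact: (viscosity_iteration_cvg Ccl Ccv TC T_nexp alpha01 fC f_ctr HRT
  a01 a_cvg0 a_div a_var b01 b_cvg0 b_var x0C xS Cq Tq Rq jP).
Qed.
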